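(* $H_{\mathrm{even}}\cap(30000,35000]$ is contained in the thirty-two-element candidate set \[ \begin{aligned} \{ & 30354, 30386, 30542, 30878, 30994, 31162, 31258, 31454,\\ & 31466, 31538, 31634, 31802, 31918, 31942, 31982, 32126, 32174,\\ & 32534, 32762, 32902, 33134, 33214, 33382, 33386, 33574, 33778,\\ & 33806, 33974, 34058, 34246, 34834, 34934 \}. \end{aligned} \]
   Context: 3-Higgs primes are defined recursively: $2$ is 3-Higgs; an odd prime $p$ is 3-Higgs if and only if every prime factor $q$ of $p-1$ is a 3-Higgs prime (necessarily $q<p$) and satisfies $v_q(p-1)\le 3$ (including $v_2(p-1)\le 3$), where $v_q$ is the $q$-adic valuation. $H$ is the set of integers $m\ge 1$ such that every prime factor of $2^m+1$ is 3-Higgs, and $H_{\mathrm{even}}=H\cap 2\mathbb{Z}$. *)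

(* Defs.v *)
From mathcomp Require Import all_boot.

Set Implicit Arguments.
Unset Strict Implicit.
Unset Printing Implicit Defensive.

(* The recursion is well founded, since a prime factor q of p - 1 is smaller
   than p; the least predicate closed under the two rules is thus the only one
   satisfying the "if and only if". *)
Inductive higgs3 : nat -> Prop :=
| higgs3_two : higgs3 2
| higgs3_odd (p : nat) :
    prime p -> odd p ->
    (forall q : nat, prime q -> q %| p - 1 -> higgs3 q) ->
    (forall q : nat, prime q -> q %| p - 1 -> logn q (p - 1) <= 3) ->
    higgs3 p.

Definition H (m : nat) : Prop :=
  1 <= m /\ forall q : nat, prime q -> q %| 2 ^ m + 1 -> higgs3 q.

Definition Heven (m : nat) : Prop := H m /\ 2 %| m.

(* Numerals above 5000 are kept by Rocq as Nat.of_num_uint applied to their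
   decimal digits. *)
Definition candidates : seq nat :=
  [:: 30354; 30386; 30542; 30878; 30994; 31162; 31258; 31454;
      31466; 31538; 31634; 31802; 31918; 31942; 31982; 32126; 32174;
      32534; 32762; 32902; 33134; 33214; 33382; 33386; 33574; 33778;
      33806; 33974; 34058; 34246; 34834; 34934].

(* Main.v *)
From Stdlib Require Import NArith Lia.
Require Import Defs.
From mathcomp Require Import all_boot.

(** An exponent [m] leaves [H] as soon as one prime [p] dividing [2 ^ m + 1] is not
    3-Higgs, and a prime [p] is not 3-Higgs as soon as [p - 1] is divisible by a
    fourth power [q ^ 4] or by a prime that is itself not 3-Higgs.

    If [4] divides [m], then either [17] divides [2 ^ m + 1], or [8] divides [m] and
    every prime [p] dividing [2 ^ m + 1] has [16] dividing [p - 1], because the order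
    of [2] modulo [p] is divisible by [16] ([not_H_mul4]).

    Otherwise [m = 2 * d] with [d] odd, and [4 ^ k + 1] divides [2 ^ m + 1 = 4 ^ d + 1]
    for every divisor [k] of [d].  Two arguments then dispose of [d].

    - Some prime [r] dividing [d] is not 3-Higgs.  Then [4 ^ r + 1] has a prime factor
      [p] other than [5], the order of [4] modulo [p] is [2 * r], so [r] divides
      [p - 1] and [p] is not 3-Higgs ([not_H_nonhiggs_divisor]).

    - For some [k] dividing [d], an explicit divisor [n] of [4 ^ k + 1] has only prime
      factors that are not 3-Higgs ([not_H_of_nonhiggs_divisor]).  These [n] were
      found by trial division and by the [p - 1] and elliptic curve methods, except
      [gauss733_factor], which is a large prime cofactor.

    That all prime factors of [n] fail to be 3-Higgs is certified without proving [n]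
    prime, by an argument in the style of Pocklington.  Let [f] divide [n - 1] and let
    [a] satisfy [a ^ (n - 1) = 1] modulo [n] while [a ^ ((n - 1) / f) - 1] is coprime
    to [n].  For a prime [p] dividing [n], the order of [a] modulo [p] divides [n - 1]
    but not [(n - 1) / f]; hence it shares a prime factor with [f], and if [f] is a prime
    [q] it is divisible by the full power of [q] in [n - 1].  As the order divides
    [p - 1], the prime [p] is not 3-Higgs when all prime factors of [f] are known not to
    be ([nonhiggs_factors_step]), or when [f = q] is a prime with [q ^ 4] dividing
    [n - 1] ([nonhiggs_factors_fourth]).  The list [certificate] chains such steps, each
    one using the earlier ones; it is checked by computation on binary numbers, as is
    the fact that the two arguments above reach every odd [d] between 15000 and 17500
    that is not half of a candidate. *)

Set Implicit Arguments.
Unset Strict Implicit.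
Unset Printing Implicit Defensive.

(** * Necessary conditions for being 3-Higgs *)

Lemma higgs3_pred_factor p q :
  odd p -> higgs3 p -> prime q -> q %| p - 1 -> higgs3 q /\ logn q (p - 1) <= 3.
Proof. by move=> op hp; case: hp op => [//|{}p pp _ h1 h2] _ pq qp; split; auto. Qed.

Lemma nonhiggs_of_factor p q :
  odd p -> prime q -> q %| p - 1 -> ~ higgs3 q -> ~ higgs3 p.
Proof. by move=> op pq qp nq /higgs3_pred_factor H; case: (H q op pq qp). Qed.

Lemma nonhiggs_of_fourth p q : odd p -> 1 < p -> prime q -> q ^ 4 %| p - 1 -> ~ higgs3 p.
Proof.
move=> op p1 pq q4 /higgs3_pred_factor h.
have p0 : 0 < p - 1 by rewrite subn_gt0.
have qp : q %| p - 1 by apply: dvdn_trans q4; rewrite dvdn_exp.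
by case: (h q op pq qp) => _; rewrite leqNgt -pfactor_dvdn // q4.
Qed.

(** * Orders modulo a prime *)

(** Bezout's identity combines [a ^ n = 1] with Fermat's little theorem.  This lets
    [gcdn n (p - 1)] stand in for the order of [a] modulo [p] below. *)
Lemma expn_gcd_mod1 p a n :
  prime p -> 0 < n -> a ^ n = 1 %[mod p] -> a ^ gcdn n (p - 1) = 1 %[mod p].
Proof.
move=> pp n0 an.
have cpa : coprime p a.
  rewrite prime_coprime //; apply/negP => pa.
  have := dvdn_exp n0 pa; rewrite /dvdn an modn_small ?prime_gt1 //.
have a0 : 0 < a.
  case: a cpa {an} => // cp0.
  by move: cp0; rewrite /coprime gcdn0 => /eqP p1; rewrite p1 in pp.
have fermat : a ^ (p - 1) = 1 %[mod p].
  apply/eqP; rewrite eqn_mod_dvd ?expn_gt0 ?a0 //.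
  rewrite -(Gauss_dvdr _ cpa) mulnBr muln1 -expnS subn1 prednK ?prime_gt0 //.
  rewrite -eqn_mod_dvd; first exact/eqP/fermat_little.
  by rewrite -{1}[a]expn1 leq_pexp2l // prime_gt0.
have [u v def_g _] := egcdnP (p - 1) n0.
have e1 k j : a ^ k = 1 %[mod p] -> a ^ (j * k) = 1 %[mod p].
  by move=> ak; rewrite mulnC expnM -modnXm ak modnXm exp1n.
have := e1 _ u an; rewrite def_g expnD -modnMml (e1 _ v fermat) modnMml mul1n.
by [].
Qed.

Lemma expn_mod1_dvd p a g n : g %| n -> a ^ g = 1 %[mod p] -> a ^ n = 1 %[mod p].
Proof.
by case/dvdnP=> k -> ag; rewrite mulnC expnM -modnXm ag modnXm exp1n.
Qed.

(** If [f] were coprime to [g = gcdn n (p - 1)], then [g], which divides [n], would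
    already divide [n %/ f]. *)
Lemma common_prime_factor p a n f :
  prime p -> 0 < n -> f %| n ->
  a ^ n = 1 %[mod p] -> a ^ (n %/ f) <> 1 %[mod p] ->
  exists2 q, prime q & (q %| f) && (q %| p - 1).
Proof.
move=> pp n0 fn an anf; set g := gcdn n (p - 1).
have ag : a ^ g = 1 %[mod p] by apply: expn_gcd_mod1.
have gf : ~~ coprime g f.
  apply/negP=> cgf; apply: anf; apply: expn_mod1_dvd ag.
  by rewrite -(Gauss_dvdr _ cgf) mulnC divnK // dvdn_gcdl.
have g0 : 0 < gcdn g f by rewrite gcdn_gt0 gcdn_gt0 n0.
exists (pdiv (gcdn g f)).
  by apply: pdiv_prime; rewrite ltn_neqAle eq_sym g0 andbT.
have d := pdiv_dvd (gcdn g f).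
rewrite (dvdn_trans d (dvdn_gcdr _ _)) /=.
exact: dvdn_trans (dvdn_trans d (dvdn_gcdl _ _)) (dvdn_gcdr _ _).
Qed.

(** If [g = gcdn n (p - 1)] lacked a factor [q] compared with [n], it would divide
    [n %/ q]. *)
Lemma full_prime_power p a n q :
  prime p -> 0 < n -> prime q -> q %| n ->
  a ^ n = 1 %[mod p] -> a ^ (n %/ q) <> 1 %[mod p] ->
  q ^ logn q n %| p - 1.
Proof.
move=> pp n0 pq qn an anq; set g := gcdn n (p - 1).
have ag : a ^ g = 1 %[mod p] by apply: expn_gcd_mod1.
have gn : g %| n by apply: dvdn_gcdl.
have g0 : 0 < g by rewrite gcdn_gt0 n0.
apply: dvdn_trans (dvdn_gcdr n (p - 1)); rewrite -/g pfactor_dvdn //.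
rewrite leqNgt; apply/negP => lt; apply: anq; apply: expn_mod1_dvd ag.
have qng : q %| n %/ g.
  have ng0 : 0 < n %/ g by rewrite divn_gt0 // dvdn_leq.
  by rewrite -[q]expn1 pfactor_dvdn // logn_div // subn_gt0.
by rewrite dvdn_divRL // -(divnK gn) [_ * g]mulnC dvdn_pmul2l.
Qed.

(** * Certificates that no prime factor is 3-Higgs *)

Definition nonhiggs_factors (n : nat) : Prop :=
  forall p, prime p -> p %| n -> ~ higgs3 p.

(** Every prime [p] dividing [n] has [p - 1] divisible by some prime factor of [f],
    by [common_prime_factor]; neither [n] nor [f] has to be prime. *)
Lemma nonhiggs_factors_step n f a :
  odd n -> 1 < n -> f %| n - 1 ->
  a ^ (n - 1) = 1 %[mod n] ->
  (forall p, prime p -> p %| n -> a ^ ((n - 1) %/ f) <> 1 %[mod p]) ->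
  nonhiggs_factors f -> nonhiggs_factors n.
Proof.
move=> on n1 fn an anf nf p pp pn.
have op : odd p by apply: dvdn_odd pn on.
have an' : a ^ (n - 1) = 1 %[mod p].
  by rewrite -(modn_dvdm _ pn) an modn_dvdm.
have n0 : 0 < n - 1 by rewrite subn_gt0.
have [q pq /andP[qf qp]] := common_prime_factor pp n0 fn an' (anf p pp pn).
exact: nonhiggs_of_factor op pq qp (nf q pq qf).
Qed.

(** The base case of a chain of certificates: by [full_prime_power], every prime [p]
    dividing [n] inherits the factor [q ^ 4] of [n - 1]. *)
Lemma nonhiggs_factors_fourth n q a :
  odd n -> 1 < n -> prime q -> q ^ 4 %| n - 1 ->
  a ^ (n - 1) = 1 %[mod n] ->
  (forall p, prime p -> p %| n -> a ^ ((n - 1) %/ q) <> 1 %[mod p]) ->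
  nonhiggs_factors n.
Proof.
move=> on n1 pq q4 an anq p pp pn.
have op : odd p by apply: dvdn_odd pn on.
have an' : a ^ (n - 1) = 1 %[mod p].
  by rewrite -(modn_dvdm _ pn) an modn_dvdm.
have n0 : 0 < n - 1 by rewrite subn_gt0.
have qn : q %| n - 1 by apply: dvdn_trans q4; rewrite dvdn_exp.
apply: (nonhiggs_of_fourth op (prime_gt1 pp) pq).
apply: dvdn_trans (full_prime_power pp n0 pq qn an' (anq p pp pn)).
by rewrite dvdn_exp2l // -pfactor_dvdn.
Qed.

(** * Exponents excluded by a single divisor *)

Lemma expn_double_mod1 p a m : 0 < a -> p %| a ^ m + 1 -> a ^ (2 * m) = 1 %[mod p].
Proof.
move=> a0 pm; apply/eqP; rewrite eqn_mod_dvd ?expn_gt0 ?a0 //.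
by rewrite mulnC expnM -[X in _ - X](exp1n 2) subn_sqr dvdn_mull.
Qed.

(** The powers of [4] modulo [25] have period 10, and equal [-1] at exponent 5 only. *)
Lemma expn4_succ_mod25 r : odd r -> ~~ (5 %| r) -> ~~ (25 %| 4 ^ r + 1).
Proof.
move=> or r5; have e25 : 4 ^ r = 4 ^ (r %% 10) %[mod 25].
  rewrite {1}(divn_eq r 10) [_ * 10]mulnC expnD expnM -modnMml -modnXm.
  have -> : 4 ^ 10 %% 25 = 1 by rewrite (expnM 4 5 2) -modnXm.
  by rewrite exp1n modnMml mul1n.
have or' : odd (r %% 10) by move: or; rewrite {1}(divn_eq r 10) oddD oddM andbF.
have r5' : ~~ (5 %| r %% 10) by rewrite /dvdn modn_dvdm.
have : r %% 10 < 10 by rewrite ltn_mod.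
rewrite /dvdn -modnDml e25 modnDml.
by move: (r %% 10) or' r5'; do 10?[case=> //].
Qed.

(** As [r] is odd, [4 ^ r + 1] is divisible by [5], and it is larger than [5]; as [r] is
    not [5], it is not divisible by [25], so it has a prime factor [p] other than [5].
    Modulo [p] the order of [4] divides [2 * r] and is not [2], because [p] does not
    divide [4 ^ 2 - 1]; this leaves the factor [r]. *)
Lemma prime_order_factor r :
  prime r -> odd r -> r != 5 ->
  exists2 p, prime p & (p %| 4 ^ r + 1) && (r %| p - 1).
Proof.
move=> pr or r5; have r1 := prime_gt1 pr.
have m5 : 5 %| 4 ^ r + 1.
  rewrite -(odd_double_half r) or -mul2n expnD expnM /dvdn -modnDml -modnMmr.
  by rewrite -modnXm exp1n.
have m25 : ~~ (25 %| 4 ^ r + 1).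
  by apply: expn4_succ_mod25 => //; rewrite dvdn_prime2 // eq_sym.
have [c def_c] := dvdnP m5.
have c1 : 1 < c.
  rewrite -(ltn_pmul2r (isT : 0 < 5)) -def_c addn1 ltnS.
  by apply: (@leq_trans (4 ^ 2)) => //; rewrite leq_exp2l.
have pp := pdiv_prime c1; set p := pdiv c in pp *.
have pc : p %| 4 ^ r + 1 by rewrite def_c dvdn_mulr ?pdiv_dvd.
have p5 : p != 5.
  apply: contraNneq m25 => p5; rewrite def_c (_ : 25 = 5 * 5) //.
  by rewrite dvdn_pmul2r // -p5 pdiv_dvd.
have p3 : p != 3.
  apply: contraTneq pc => ->; rewrite /dvdn -modnDml -modnXm.
  by rewrite (_ : 4 %% 3 = 1) // exp1n.
exists p; rewrite // pc /=.
have n0 : 0 < 2 * r by rewrite muln_gt0 (prime_gt0 pr).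
have an : 4 ^ (2 * r) = 1 %[mod p] by apply: expn_double_mod1.
have rn : r %| 2 * r by rewrite dvdn_mull.
apply: dvdn_trans (full_prime_power pp n0 pr rn an _).
  by rewrite -{1}[r]expn1 dvdn_exp2l // -pfactor_dvdn ?expn1.
rewrite mulnK ?(ltnW r1) // => /eqP; rewrite eqn_mod_dvd // -/(4 ^ 2).
rewrite (_ : 4 ^ 2 - 1 = 3 * 5) // Euclid_dvdM // !dvdn_prime2 //.
by rewrite (negPf p3) (negPf p5).
Qed.

(** Excludes the exceptional case [r = 5] of [prime_order_factor]. *)
Lemma higgs3_5 : higgs3 5.
Proof.
have q2 q : prime q -> q %| 5 - 1 -> q = 2.
  move=> pq; rewrite (_ : 5 - 1 = 2 ^ 2) // Euclid_dvdX // dvdn_prime2 //.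
  by case/andP=> /eqP.
apply: higgs3_odd => // q pq /(q2 _ pq) -> //; exact: higgs3_two.
Qed.

Lemma expn_succ_dvd a k d : k %| d -> odd d -> a ^ k + 1 %| a ^ d + 1.
Proof.
case/dvdnP=> j ->; rewrite oddM => /andP[oj _].
rewrite mulnC expnM; move: (a ^ k) => b.
rewrite -(odd_double_half j) oj; elim: (j./2) => [|i IH]; first by rewrite expn1.
set n := true + i.*2 in IH *.
have -> : true + i.+1.*2 = n.+2 by rewrite doubleS !addnS.
(* With [X n := b ^ n + 1]: [X n.+2 + b ^ n * (b + 1) = b ^ n.+1 * (b + 1) + X n]. *)
rewrite -(dvdn_addl _ (dvdn_mull (b ^ n) (dvdnn (b + 1)))).
have -> : b ^ n.+2 + 1 + b ^ n * (b + 1) = b ^ n.+1 * (b + 1) + (b ^ n + 1).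
  rewrite !mulnDr !muln1 -!expnSr -addnA [1 + _]addnC -!addnA.
  by rewrite [b ^ n + 1]addnC.
by rewrite dvdn_addr ?IH // dvdn_mull.
Qed.

Lemma not_H_of_nonhiggs_divisor m n :
  1 < n -> nonhiggs_factors n -> n %| 2 ^ m + 1 -> ~ H m.
Proof.
move=> n1 nn nm [_ h]; apply: (nn (pdiv n)); rewrite ?pdiv_prime ?pdiv_dvd //.
by apply: h; rewrite ?pdiv_prime // (dvdn_trans (pdiv_dvd n)).
Qed.

(** When [8] divides [m], the order of [2] modulo any prime [p] dividing [2 ^ m + 1] has
    the same power of [2] as [2 * m], so [16] divides [p - 1].  When [m] is [4] times an
    odd number, [17 = 2 ^ 4 + 1] divides [2 ^ m + 1]. *)
Lemma not_H_mul4 m : 0 < m -> 4 %| m -> ~ H m.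
Proof.
move=> m0 m4 [_ h].
have M1 : 1 < 2 ^ m + 1 by rewrite addn1 ltnS expn_gt0.
case: (boolP (8 %| m)) => m8.
  have pp := pdiv_prime M1; set p := pdiv _ in pp.
  have pM : p %| 2 ^ m + 1 := pdiv_dvd _.
  have op : odd p by apply: dvdn_odd pM _; rewrite addn1 oddS oddX orbF -lt0n m0.
  apply: (nonhiggs_of_fourth op (prime_gt1 pp) (isT : prime 2) _ (h p pp pM)).
  have n0 : 0 < 2 * m by rewrite muln_gt0.
  have an : 2 ^ (2 * m) = 1 %[mod p] by apply: expn_double_mod1.
  have rn : 2 %| 2 * m by rewrite dvdn_mulr.
  apply: dvdn_trans (full_prime_power pp n0 (isT : prime 2) rn an _).
    by rewrite dvdn_exp2l // -pfactor_dvdn // (_ : 2 ^ 4 = 2 * 8) // dvdn_pmul2l.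
  rewrite mulKn // => /eqP; rewrite eqn_mod_dvd ?expn_gt0 // => pm.
  have : p %| 2 ^ m + 1 - (2 ^ m - 1) by apply: dvdn_sub.
  rewrite subnBA ?expn_gt0 // -addnA addKn dvdn_prime2 // => /eqP p2.
  by rewrite p2 in op.
have om : odd (m %/ 4).
  apply: contraR m8; rewrite -dvdn2 => /dvdnP[j ej].
  by rewrite -(divnK m4) ej -mulnA dvdn_mull.
have pM : 17 %| 2 ^ m + 1.
  by rewrite -(divnK m4) mulnC expnM; apply: (@expn_succ_dvd (2 ^ 4) 1).
by apply: (@nonhiggs_of_fourth 17 2) (h 17 _ pM).
Qed.

Lemma not_H_nonhiggs_divisor d r :
  odd d -> 1 < r -> nonhiggs_factors r -> r %| d -> ~ H (2 * d).
Proof.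
move=> od r1 nr rd.
have pq := pdiv_prime r1; set q := pdiv r in pq.
have qr : q %| r := pdiv_dvd r; have qd := dvdn_trans qr rd.
have nq : ~ higgs3 q by apply: nr.
have oq : odd q by apply: dvdn_odd qd od.
have q5 : q != 5 by apply/eqP=> q5; apply: nq; rewrite q5; apply: higgs3_5.
have [p pp /andP[p4 qp]] := prime_order_factor pq oq q5.
have pM : p %| 2 ^ (2 * d) + 1.
  by rewrite expnM; apply: dvdn_trans p4 (expn_succ_dvd _ qd od).
have op : odd p.
  by apply: dvdn_odd p4 _; rewrite addn1 oddS oddX orbF -lt0n odd_gt0.
case=> _ /(_ p pp pM); exact: nonhiggs_of_factor op pq qp nq.
Qed.

(** * Computation on binary numbers *)

Lemma to_nat_divmod a b : b <> 0%num ->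
  N.to_nat (N.div a b) = N.to_nat a %/ N.to_nat b /\
  N.to_nat (N.modulo a b) = N.to_nat a %% N.to_nat b.
Proof.
move=> b0; have lt : N.to_nat (N.modulo a b) < N.to_nat b.
  by apply/ltP; have := N.mod_lt a b b0; lia.
rewrite {2 4}(N.Div0.div_mod a b); move: (N.div a b) (N.modulo a b) lt => q r lt.
rewrite N2Nat.inj_add N2Nat.inj_mul plusE multE mulnC modnMDl modn_small //.
by rewrite divnMDl ?divn_small ?addn0 //; apply: leq_ltn_trans lt.
Qed.

Lemma to_nat_mod a b : b <> 0%num -> N.to_nat (N.modulo a b) = N.to_nat a %% N.to_nat b.
Proof. by case/(to_nat_divmod a). Qed.

Lemma to_nat_div a b : b <> 0%num -> N.to_nat (N.div a b) = N.to_nat a %/ N.to_nat b.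
Proof. by case/(to_nat_divmod a). Qed.

Lemma to_nat_divide a b : N.divide a b <-> N.to_nat a %| N.to_nat b.
Proof.
split=> [[q ->]|/dvdnP[q e]]; first by rewrite N2Nat.inj_mul multE dvdn_mull.
by exists (N.of_nat q); apply: N2Nat.inj; rewrite N2Nat.inj_mul Nat2N.id e.
Qed.

Lemma dvdn_to_nat a b : b <> 0%num -> (N.to_nat b %| N.to_nat a) = N.eqb (N.modulo a b) 0.
Proof.
move=> b0; rewrite /dvdn -to_nat_mod //.
by case: N.eqb_spec => [->|] //; move: (N.modulo _ _) => r r0; apply/eqP; lia.
Qed.

(** The reduction is a parameter so that [gauss733_factor] below can avoid long
    division. *)
Fixpoint pow_reduced (red : N -> N) (a : N) (e : positive) : N :=
  match e with
  | xH => red a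
  | xO e => red (N.square (pow_reduced red a e))
  | xI e => red (N.mul a (red (N.square (pow_reduced red a e))))
  end.

Definition power (red : N -> N) (a e : N) : N :=
  if e is Npos e then pow_reduced red a e else 1%num.

Definition preserves_mod (red : N -> N) (m : nat) : Prop :=
  forall x, N.to_nat (red x) = N.to_nat x %[mod m].

Lemma powerE red m a e : preserves_mod red m ->
  N.to_nat (power red a e) = N.to_nat a ^ N.to_nat e %[mod m].
Proof.
move=> redE; case: e => [|e] //=.
have sq b k : N.to_nat b = k %[mod m] -> N.to_nat (red (N.square b)) = k * k %[mod m].
  by move=> bk; rewrite redE N.square_spec N2Nat.inj_mul multE -modnMm bk modnMm.
elim: e => [e /sq IH|e /sq IH|] /=; last by rewrite redE Pnat.Pos2Nat.inj_1 expn1.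
- rewrite redE N2Nat.inj_mul multE -modnMmr IH modnMmr Pnat.Pos2Nat.inj_xI multE expnS.
  by rewrite mul2n -addnn expnD.
- by rewrite IH Pnat.Pos2Nat.inj_xO multE mul2n -addnn expnD.
Qed.

Lemma modulo_preserves n : n <> 0%num ->
  preserves_mod (fun x => N.modulo x n) (N.to_nat n).
Proof. by move=> n0 x; rewrite to_nat_mod // modn_mod. Qed.

(** [4 ^ 733 + 1] is the product of [2 ^ 733 - 2 ^ 367 + 1] and this number. *)
Definition gauss733 : N := N.add (N.shiftl 1 733) (N.add (N.shiftl 1 367) 1).

(** Rewrites the bits of [x] from position 733 on by [2 ^ 733 = - (2 ^ 367 + 1)] modulo
    [gauss733]; adding [2 ^ i * gauss733] keeps the difference positive. *)
Definition fold733 (i x : N) : N :=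
  let hi := N.shiftr x 733 in
  let u := N.add hi (N.shiftl hi 367) in
  let v := N.shiftl gauss733 i in
  if N.leb u v then N.add (N.land x (N.ones 733)) (N.sub v u) else x.

Lemma fold733_preserves i : preserves_mod (fold733 i) (N.to_nat gauss733).
Proof.
move=> x; rewrite /fold733 /gauss733.
rewrite N.shiftr_div_pow2 N.land_ones !N.shiftl_mul_pow2 !N.mul_1_l.
have := N.Div0.div_mod x (N.pow 2 733).
move: (N.div _ _) (N.modulo _ _) => hi lo.
move: (N.pow 2 733) (N.pow 2 367) (N.pow 2 i) => b c k ex.
case: N.leb_spec => // uv; set m := N.add b _ in uv *.
have : N.add (N.add lo (N.sub (N.mul m k) (N.add hi (N.mul hi c)))) (N.mul hi m)
     = N.add x (N.mul k m).
  by rewrite ex /m in uv *; nia.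
move/(congr1 N.to_nat); rewrite N2Nat.inj_add [RHS]N2Nat.inj_add.
rewrite !(N2Nat.inj_mul _ m) !plusE !multE => e.
by rewrite -[LHS](modnMDl (N.to_nat hi)) addnC e addnC modnMDl.
Qed.

(** The shifts suit the square of a number of 735 bits: one fold leaves about 1110 bits,
    a second one about 750 and the last one 735. *)
Definition reduce733 (x : N) : N := fold733 0 (fold733 16 (fold733 376 x)).

(** A prime factor of [gauss733].  It has 714 bits, while every other number to be
    certified has fewer than 100, and long division modulo it would dominate the
    computation. *)
Definition gauss733_factor : N :=
  72012583236775387244518265986995031968529175422425153908818773946253960538273510673367847802647992030482741781839093529266957797404901070128504450433228045567301375752063836718657402234369864653435720743696693235529.

Definition reduction (n : N) : N -> N :=
  if N.eqb n gauss733_factor then reduce733 else fun x => N.modulo x n.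

Lemma reduction_preserves n : n <> 0%num -> preserves_mod (reduction n) (N.to_nat n).
Proof.
move=> n0; rewrite /reduction; case: N.eqb_spec => [->|_]; last exact: modulo_preserves.
have dv : N.to_nat gauss733_factor %| N.to_nat gauss733 by rewrite dvdn_to_nat.
move=> x; rewrite -(modn_dvdm _ dv) /reduce733.
by do 3!rewrite fold733_preserves; rewrite (modn_dvdm _ dv).
Qed.

(** [N.gcd] is applied to [a ^ ((n - 1) / f) + (n - 1)], which is congruent to
    [a ^ ((n - 1) / f) - 1] modulo [n] and cannot underflow. *)
Definition order_witness (n f a : N) : bool :=
  let b := power (reduction n) a (N.div (N.pred n) f) in
  N.eqb (N.modulo (power (reduction n) b f) n) 1 && N.eqb (N.gcd (N.add b (N.pred n)) n) 1.

Lemma order_witnessP n f a :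
  (1 < n)%num -> f <> 0%num -> N.to_nat f %| N.to_nat n - 1 -> order_witness n f a ->
  N.to_nat a ^ (N.to_nat n - 1) = 1 %[mod N.to_nat n] /\
  forall p, prime p -> p %| N.to_nat n ->
    N.to_nat a ^ ((N.to_nat n - 1) %/ N.to_nat f) <> 1 %[mod p].
Proof.
set m := N.to_nat n => n1 f0 fm; rewrite /order_witness.
have n0 : n <> 0%num by move=> n0; rewrite n0 in n1.
have m1 : 1 < m by apply/ltP; rewrite /m; lia.
have pm : N.to_nat (N.pred n) = m - 1 by rewrite N2Nat.inj_pred subn1.
have := powerE a (N.div (N.pred n) f) (reduction_preserves n0); rewrite to_nat_div // pm.
move: (power _ _ _) => b eb /andP[/N.eqb_spec bf /N.eqb_spec bgcd].
split.
  rewrite -{1}(divnK fm) expnM -modnXm -eb modnXm.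
  by rewrite -(powerE b f (reduction_preserves n0)) -to_nat_mod // bf modn_small.
move=> p pp pn ap.
have bp : N.to_nat b = 1 %[mod p] by rewrite -(modn_dvdm _ pn) eb (modn_dvdm _ pn).
have : N.divide (N.of_nat p) 1.
  rewrite -bgcd; apply: N.gcd_greatest; apply/to_nat_divide; rewrite Nat2N.id //.
  rewrite N2Nat.inj_add pm plusE /dvdn -modnDml bp modnDml.
  by rewrite addnC subnK ?(ltnW m1).
by move/to_nat_divide; rewrite Nat2N.id dvdn1 => /eqP p1; rewrite p1 in pp.
Qed.

Definition small_primes : seq N := [:: 2; 3]%num.

(** One link of a chain: [f] is either one of the numbers [known] to have no 3-Higgs
    prime factor, or a small prime whose fourth power divides [n - 1]. *)
Definition nonhiggs_step (known : seq N) (n f a : N) : bool :=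
  let n1 := N.pred n in
  [&& N.ltb 1 n, N.odd n, N.eqb (N.modulo n1 f) 0,
      (f \in known) || (f \in small_primes) && N.eqb (N.modulo n1 (N.pow f 4)) 0 &
      order_witness n f a].

Fixpoint nonhiggs_chain (known : seq N) (steps : seq (N * N * N)) : bool :=
  if steps is (n, f, a) :: steps' then
    nonhiggs_step known n f a && nonhiggs_chain (n :: known) steps'
  else true.

Lemma nonhiggs_stepP known n f a :
  (forall k, k \in known -> nonhiggs_factors (N.to_nat k)) ->
  nonhiggs_step known n f a -> nonhiggs_factors (N.to_nat n).
Proof.
move=> kn /and5P[/N.ltb_spec0 n1 on /N.eqb_spec fn kf wa].
have small f' : f' \in small_primes -> prime (N.to_nat f').
  exact: (allP (isT : all (fun q => prime (N.to_nat q)) small_primes)).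
have f0 : f <> 0%num.
  case/orP: kf => [fk|/andP[fs _]] f0; last by move: (small _ fs); rewrite f0.
  by move: (kn _ fk); rewrite f0 => /(_ 2 isT isT); apply; exact: higgs3_two.
have m1 : 1 < N.to_nat n by apply/ltP; lia.
have om : odd (N.to_nat n).
  move/N.odd_spec: on => [j ->]; rewrite N2Nat.inj_add N2Nat.inj_mul plusE multE.
  by rewrite oddD oddM.
have dv g : g <> 0%num -> N.modulo (N.pred n) g = 0%num -> N.to_nat g %| N.to_nat n - 1.
  by move=> g0 gn; rewrite subn1 -N2Nat.inj_pred dvdn_to_nat // gn.
have [an anf] := order_witnessP n1 f0 (dv _ f0 fn) wa.
case/orP: kf => [fk|/andP[/small pf /N.eqb_spec f4]].
  exact: nonhiggs_factors_step om m1 (dv _ f0 fn) an anf (kn f fk).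
apply: (nonhiggs_factors_fourth om m1 pf _ an anf).
have -> : N.to_nat f ^ 4 = N.to_nat (N.pow f 4).
  by rewrite (_ : N.pow f 4 = N.mul f (N.mul f (N.mul f f))) ?N2Nat.inj_mul //; lia.
by apply: dv f4; exact: N.pow_nonzero.
Qed.

Lemma nonhiggs_chainP known steps :
  (forall k, k \in known -> nonhiggs_factors (N.to_nat k)) ->
  nonhiggs_chain known steps ->
  forall n, n \in [seq s.1.1 | s <- steps] -> nonhiggs_factors (N.to_nat n).
Proof.
elim: steps known => [|[[n f] a] steps IH] known kn //= /andP[st ch] k.
have nn := nonhiggs_stepP kn st.
rewrite inE => /orP[/eqP ->|]; first exact: nn.
by apply: IH ch k => k; rewrite inE => /orP[/eqP ->|/kn].
Qed.

(** * The certificates *)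

(** Triples [(n, f, a)] as in [nonhiggs_step], each [f] being a small prime or the first
    component of an earlier triple. *)
Definition certificate : seq (N * N * N) :=
  [:: (17, 2, 3); (97, 2, 5); (103, 17, 2); (113, 2, 3); (137, 17, 2); (163, 3, 2);
      (193, 2, 5); (227, 113, 2); (239, 17, 2); (241, 2, 7); (257, 2, 3); (389, 97, 2);
      (401, 2, 3); (409, 17, 2); (487, 3, 2); (653, 163, 2); (673, 2, 5); (1009, 2, 11);
      (1021, 17, 2); (1031, 103, 2); (1097, 137, 2); (1123, 17, 2); (1153, 2, 5);
      (593, 2, 3); (1187, 593, 2); (1201, 2, 11); (1217, 2, 3); (307, 17, 2); (1229, 307, 2);
      (1237, 103, 2); (1249, 2, 7); (1259, 17, 2); (641, 2, 3); (1283, 641, 2); (1297, 2, 5);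
      (1307, 653, 2); (1327, 17, 2); (1667, 17, 2); (1697, 2, 3); (433, 2, 5);
      (1733, 433, 2); (1747, 97, 2); (1777, 2, 5); (1783, 3, 2); (1871, 17, 2); (1873, 2, 5);
      (1889, 2, 3); (953, 17, 2); (1907, 953, 2); (1913, 239, 2); (1931, 193, 2);
      (3041, 2, 3); (3061, 17, 2); (3079, 3, 2); (3089, 2, 3); (3121, 2, 7); (3137, 2, 3);
      (3163, 17, 2); (1583, 113, 2); (3167, 1583, 2); (3169, 2, 7); (1601, 2, 3);
      (3203, 1601, 2); (3209, 401, 2); (3217, 2, 5); (3299, 17, 2); (3313, 2, 5);
      (3329, 2, 3); (3347, 239, 2); (3361, 2, 11); (337, 2, 5); (3371, 337, 2);
      (3391, 113, 2); (3457, 2, 5); (577, 2, 5); (3463, 577, 2); (3467, 1733, 2);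
      (3469, 17, 2); (5009, 2, 3); (5023, 3, 2); (5101, 17, 2); (5153, 2, 3);
      (5189, 1297, 2); (5197, 433, 2); (5233, 2, 5); (5237, 17, 2); (5281, 2, 7);
      (5297, 2, 3); (5303, 241, 2); (5309, 1327, 2); (443, 17, 2); (887, 443, 2);
      (5323, 887, 2); (5347, 3, 3); (2693, 673, 2); (5387, 2693, 2); (5393, 2, 3);
      (5407, 17, 2); (5441, 2, 3); (5449, 227, 2); (2741, 137, 2); (5483, 2741, 2);
      (2753, 2, 3); (5507, 2753, 2); (5521, 2, 7); (5527, 307, 2); (5563, 103, 2);
      (5569, 2, 13); (1409, 2, 3); (2819, 1409, 2); (5639, 2819, 2); (5651, 113, 2);
      (1429, 17, 3); (5717, 1429, 2); (5737, 239, 2); (479, 239, 2); (5749, 479, 2);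
      (5791, 193, 2); (5821, 97, 2); (971, 97, 2); (5827, 971, 2); (15073, 2, 5);
      (15121, 2, 11); (15131, 17, 2); (15137, 2, 3); (3793, 2, 5); (15173, 3793, 2);
      (15199, 17, 2); (15217, 2, 5); (15233, 2, 3); (7649, 2, 3); (15299, 7649, 2);
      (2551, 17, 2); (15307, 2551, 2); (15313, 2, 5); (15329, 2, 3); (15359, 1097, 2);
      (15361, 2, 7); (15377, 2, 3); (769, 2, 7); (7691, 769, 2); (15383, 7691, 2);
      (15391, 3, 2); (15451, 103, 2); (773, 193, 2); (15461, 773, 2); (15473, 2, 3);
      (2593, 2, 5); (15559, 2593, 2); (15569, 2, 3); (15601, 2, 7); (15607, 17, 2);
      (15619, 137, 2); (15641, 17, 2); (3911, 17, 2); (7823, 3911, 2); (15647, 7823, 2);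
      (15649, 2, 11); (7841, 2, 3); (15683, 7841, 2); (15761, 2, 3); (15809, 2, 3);
      (881, 2, 3); (15859, 881, 2); (15877, 3, 3); (15889, 2, 7); (15907, 241, 2);
      (15913, 17, 2); (15937, 2, 5); (16001, 2, 3); (16033, 2, 5); (16069, 103, 2);
      (16097, 2, 3); (16103, 97, 2); (2017, 2, 5); (8069, 2017, 2); (16139, 8069, 2);
      (8093, 17, 2); (16187, 8093, 2); (16193, 2, 3); (811, 3, 3); (8111, 811, 2);
      (16223, 8111, 2); (16253, 17, 2); (16273, 2, 5); (16301, 163, 2); (1361, 2, 3);
      (16333, 1361, 2); (16339, 389, 2); (16361, 409, 2); (16363, 3, 2); (16369, 2, 7);
      (16417, 2, 5); (16433, 2, 3); (16447, 2741, 2); (16481, 2, 3); (16519, 2753, 2);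
      (16529, 2, 3); (8273, 2, 3); (16547, 8273, 2); (16561, 2, 7); (16619, 1187, 2);
      (2081, 2, 3); (16649, 2081, 2); (16657, 2, 5); (16661, 17, 2); (16673, 2, 3);
      (16729, 17, 2); (16763, 17, 2); (647, 17, 2); (16823, 647, 2); (16831, 17, 2);
      (16843, 401, 2); (16871, 241, 2); (16879, 97, 2); (16963, 257, 2); (16979, 653, 2);
      (16993, 2, 5); (17011, 3, 2); (8513, 2, 3); (17027, 8513, 2); (2129, 2, 3);
      (17033, 2129, 2); (17041, 2, 7); (4273, 2, 5); (17093, 4273, 2); (17099, 103, 2);
      (17117, 389, 2); (17137, 2, 5); (17207, 1229, 2); (17209, 239, 2); (17239, 17, 2);
      (17321, 433, 2); (619, 103, 2); (17333, 619, 2); (17341, 17, 2); (17377, 2, 5);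
      (2897, 2, 3); (17383, 2897, 2); (17393, 2, 3); (17443, 17, 2); (17471, 1747, 2);
      (17477, 17, 2); (17489, 2, 3); (17497, 3, 2); (2113, 2, 5); (525313, 2, 5);
      (8101, 3, 3); (246241, 2, 11); (107367629, 113, 3); (500177, 2, 3); (54001, 2, 7);
      (3761, 2, 3); (15358129, 2, 7); (157649, 2, 3); (23609, 227, 2);
      (108140989558681, 23609, 3); (83761, 2, 7); (2559066073, 83761, 3);
      (148587949, 953, 3); (9929, 17, 3); (381364611866507317969, 2, 11); (13063537, 2, 5);
      (1067851, 113, 2); (23492723, 1067851, 2); (9491060093, 23492723, 3);
      (23528569104401, 2, 3); (929, 2, 3); (7433, 929, 2); (74323515777853, 7433, 3);
      (26417, 2, 3); (269665073, 2, 3); (1408349, 17, 3); (75005713, 2, 5);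
      (180201997, 3, 7); (13625405957, 17, 3); (1470213697, 2, 5);
      (28739737348957, 1470213697, 3); (5080081, 2, 7); (25212001, 2, 7); (95768689, 2, 17);
      (371179, 17, 2); (57762875981, 371179, 3); (99972364781, 17, 3); (8609, 2, 3);
      (318538204183, 3, 3); (987879984327104437, 318538204183, 3); (3827221, 227, 3);
      (4353761, 2, 3); (130612831, 4353761, 2); (92525303484856757, 130612831, 3);
      (25409, 2, 3); (25793, 2, 3); (53633, 2, 3); (2264737, 2, 5);
      (350862114989, 2264737, 3); (103837, 17, 3); (8369, 2, 3); (425654561, 2, 3);
      (111697, 2, 5); (1281089, 2, 3); (1534153, 97, 3); (36371821254913, 2, 5);
      (480170172376488257, 2, 3); (10993, 2, 5); (11057, 2, 3); (1649929681, 2, 29);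
      (980996410232957, 97, 3); (3999625314127057, 2, 5);
      (95991007539049369, 3999625314127057, 2);
      (635652451923584921519, 95991007539049369, 2);
      (gauss733_factor, 635652451923584921519, 3); (170756297, 17, 3); (260683037, 239, 3);
      (207877, 17, 3); (47577889, 2, 11); (1513441, 2, 7); (49459577, 5827, 3);
      (119057, 2, 3); (13155349, 17, 3); (525029, 17, 3); (36833, 2, 3); (37217, 2, 3);
      (13152673, 2, 5); (7493076529, 2, 17); (170263, 3, 2); (293731580424649, 170263, 3);
      (37960322381, 17, 3); (61297, 2, 5); (31081508849, 2, 3);
      (1146568796702009883941, 31081508849, 3); (2206769, 2, 3); (62643029, 17, 3);
      (18401, 2, 3); (147209, 18401, 2); (28736963309, 147209, 3); (592880653, 137, 3);
      (603008777268061313, 2, 3); (85967393, 2, 3); (2099331561841897633, 2, 5);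
      (23509, 653, 2); (6923494537, 23509, 3); (5796361, 3, 5); (58337, 2, 3);
      (46229089, 2, 17); (88657, 2, 5); (1949940913, 2, 5); (22810159626697, 17, 3);
      (4884847621, 113, 3); (48017, 2, 3); (3034173155873, 2, 3); (290209, 2, 7);
      (731761, 2, 11); (674929, 2, 7); (8280028973, 674929, 3); (3229479101, 1667, 2);
      (39825936273533, 3229479101, 3); (1698253, 137, 3); (198977, 2, 3); (64326257, 2, 3);
      (5349901, 17, 3); (90556709, 647, 3); (50993, 2, 3); (1952893, 17, 3); (1185329, 2, 3);
      (73052897, 2, 3); (1145057, 2, 3); (14650239496544101, 137, 3); (2555057, 2, 3);
      (10476577, 2, 5); (6943330769, 2, 3); (161233, 2, 5); (2609, 2, 3);
      (541861937294157972258937, 2609, 3); (2071457, 2, 3); (54833, 2, 3);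
      (6306332272417, 2, 5); (1772033, 2, 3); (6617801501, 103, 3); (1029356261, 641, 3);
      (38097113, 1361, 3); (6975313, 2, 5); (263875783252905713, 2, 3); (81041, 2, 3);
      (11633, 2, 3); (472485929, 11633, 3); (2275393, 2, 5); (19757909, 971, 3);
      (2687, 17, 3); (54804053, 2687, 3); (7680929, 2, 3); (1740461, 17, 3);
      (3978553, 97, 3); (13227521, 2, 3); (1189330001, 2, 3); (15251953, 2, 5);
      (2609287649, 2, 3); (49355281, 2, 7); (1794181, 17, 3); (45795961, 17, 3);
      (39613729, 2, 17); (171553, 2, 5); (38656796809, 17, 3); (518689, 2, 7);
      (49063433, 103, 3); (3553553, 2, 3); (422364721, 2, 17); (508402997, 97, 3);
      (4729873, 2, 5); (993230477350621, 4729873, 3); (1112821, 17, 3); (4488817, 2, 5);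
      (1921735649, 2, 3); (1247009, 2, 3); (4551144491420249, 1247009, 3); (88721, 2, 3);
      (87044849, 2, 3); (8671589, 389, 3); (40902436574189, 3347, 3); (1341841, 2, 11);
      (5556193, 2, 5); (77800673, 2, 3); (270961, 2, 7); (45943993, 113, 3); (7326289, 2, 7);
      (2161, 2, 7); (12967, 2161, 2); (51869, 12967, 2); (11929871, 51869, 2);
      (269949120989, 11929871, 3); (385493, 17, 3); (12752653, 17, 5); (145168676273, 2, 3);
      (25905097, 3, 3); (126761281, 2, 7); (5857861, 17, 3); (2773921, 2, 7);
      (31135673, 673, 3); (2969089, 2, 11); (2529421633, 2, 5); (743297, 2, 3);
      (289673701, 193, 3); (5835267153879179953, 2, 5); (420430468457, 1429, 3);
      (548196107057, 2, 3); (65919485481390137, 548196107057, 3); (2001348131115761, 2, 3);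
      (240881, 2, 3); (7229281, 2, 7); (20336202478149256973722417, 2, 5); (89137, 2, 5);
      (1674527683, 89137, 2); (2119341458736479619933149, 1674527683, 3); (1447969, 2, 7);
      (105274817, 2, 3); (483233, 2, 3); (1208561, 2, 3); (241873, 2, 5); (484129, 2, 11);
      (32783, 443, 2); (3970414697, 32783, 3); (8685958376369, 2, 3); (5367539797, 163, 3);
      (115891921, 2, 7); (270851032801, 2, 7); (487073, 2, 3); (298363928801, 2, 3);
      (20353, 2, 5); (136304682777048034541, 20353, 3); (2536435201, 2, 7);
      (8437379, 443, 2); (52162834096079628121, 8437379, 3); (488417, 2, 3);
      (1851335713, 2, 5); (1336798609, 2, 7); (1039517, 17, 5); (311757999001, 971, 3);
      (1223281, 2, 7); (31197721, 17, 3); (4411873, 2, 5); (6861787657, 17, 3);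
      (10203011953, 2, 5); (187754677829, 409, 3); (26626037, 433, 3); (113597777, 2, 3);
      (449, 2, 3); (40896978010656137, 449, 3); (246833, 2, 3); (80918721655787107, 103, 2);
      (54976503167828383644229, 80918721655787107, 3); (13154564244428801, 2, 3);
      (8166577, 2, 5); (1732529, 2, 3); (247889, 2, 3); (2334632084689, 2, 13);
      (723682417, 2, 5); (22469, 137, 2); (1396403413, 22469, 3); (890822091773, 17, 3);
      (248657, 2, 3); (5577838589381, 307, 3); (98314794808753, 2, 5); (21211909, 113, 3);
      (2758470218437, 3137, 3); (250673, 2, 3); (501409, 2, 7); (11900946040801, 2, 7);
      (326737, 2, 5); (61474913077, 326737, 3); (6272401, 2, 13); (2149187737, 17, 3);
      (6029953, 2, 5); (8558262071779621, 593, 3); (14283749, 227, 3); (49755484057, 103, 3);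
      (28679324144425313, 2, 3); (392339089, 2, 11); (90681962730402289, 2, 41);
      (5110047762237329, 2, 3); (2790932646868953247750880209, 2, 7); (6359, 17, 2);
      (4438583, 6359, 2); (841075969837, 4438583, 3); (96527, 17, 2); (1930541, 96527, 2);
      (7936597814527189, 1930541, 3); (172126277, 389, 3); (7729963860257, 2, 3);
      (1013569, 2, 11); (1944301873515565961, 97, 3); (182827597, 137, 3); (823, 137, 2);
      (104679017, 823, 3); (1211039269580314693, 3, 11); (182095429, 953, 3);
      (1784273, 2, 3); (1644835649, 2, 3); (19582777, 17, 3); (10162046049931438241, 2, 3);
      (99913873, 2, 5); (33013193, 257, 3); (2655761, 2, 3); (47803699, 2655761, 2);
      (44075010479, 47803699, 2); (352600083833, 44075010479, 2);
      (850146065159844967561, 352600083833, 3); (1584122137457, 2, 3);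
      (3810358523810747273, 15217, 3); (1540874161, 2, 11); (15659893, 3, 3);
      (633412209423649, 2, 7); (13703767301293, 257, 3); (338098993, 2, 5);
      (108018482597, 17, 3); (3302557, 17, 3); (63737, 257, 2); (177783143789, 63737, 3);
      (2230044337, 2, 5); (2171483372710381, 2230044337, 3); (5793459898913, 2, 3);
      (342658913, 2, 3); (3901201, 2, 7); (1312200013, 17, 3); (97497313, 2, 5);
      (8345089, 2, 17); (4344576169, 17, 5); (2160978281026383953, 2, 3);
      (526195050049, 2, 13); (29373581, 449, 3); (21601, 2, 7); (25250964173, 21601, 2);
      (303011570077, 25250964173, 2); (1818069420463, 303011570077, 2);
      (1790180235553097581, 1818069420463, 3); (29257175071693, 227, 3); (788209, 2, 13);
      (4979329373617, 2, 5); (2103169, 2, 7); (915242169987001473432769, 2, 11);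
      (93418972107830609, 2, 3); (4706474198449, 2, 17); (1621, 3, 2);
      (8255653400675668661, 1621, 3); (26117480969600369, 2, 3); (44365441, 2, 11);
      (11108833, 2, 5); (6888431633, 2, 3); (23069617, 2, 5); (7057, 2, 5); (28229, 7057, 2);
      (8976823, 28229, 2); (10037010141443977, 8976823, 3); (51776401, 2, 7);
      (165356914381, 1031, 3); (265841, 2, 3); (7016153233, 2, 5); (23873, 2, 3);
      (3629307626261, 23873, 3); (2267960365874661233, 2, 3); (799441, 2, 7); (9781, 163, 2);
      (28093262069, 9781, 3); (1336241, 2, 3); (199782509, 103, 3); (1222299249121, 2, 7);
      (21397, 1783, 2); (151934277017, 21397, 3); (5897761, 2, 29); (1301987336597, 17, 3);
      (268529, 2, 3); (806929, 2, 11); (5468482577, 2, 3); (9714241, 2, 7);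
      (616875233443213, 17, 3); (265739, 257, 2); (30578144017460391589, 265739, 3);
      (43339476130371151553, 2, 3); (47041531633, 2, 5); (54979, 17, 2); (219917, 54979, 2);
      (3078839, 219917, 2); (1456490161074204979529, 3078839, 3); (1231188011327, 1307, 2);
      (916649022945223349, 1231188011327, 3); (13873, 2, 5); (499118861480510377, 13873, 3);
      (2840698891969, 2, 17); (58669769, 433, 3); (6257, 2, 3); (216720625099897, 6257, 3);
      (4340993, 2, 3); (33632183989, 3, 5); (3799804409, 337, 3); (82722061, 3, 3);
      (185198609, 2, 3); (33926875289, 577, 3); (49312935281, 2, 3); (5461441, 2, 7);
      (273233, 2, 3); (4968030251773, 3, 3); (10651776193, 2, 5); (114784455464941, 103, 5);
      (136348804301, 17, 3); (407579363088721, 2, 7); (613, 17, 2); (6131, 613, 2);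
      (11017395596341, 6131, 3); (321497280497, 2, 3); (43183793, 2, 3);
      (1646391749, 823, 2); (673971187232486413, 1646391749, 3); (16472837, 239, 3);
      (276113, 2, 3); (2477, 619, 2); (1539197893, 2477, 3); (33563, 97, 2);
      (2080907, 33563, 2); (224737957, 2080907, 2); (62152014654089821, 224737957, 3);
      (71830721, 2, 3); (19622129, 2, 3); (64780561, 2, 7);
      (119530318030944713, 64780561, 3); (609864170129866021, 137, 3); (282734857, 227, 3);
      (277073, 2, 3); (4866807761, 2, 3); (2878877921, 2, 3); (53103344348017, 2, 5);
      (187496296013357, 241, 3); (371815146090233137, 2, 5); (8352481, 2, 13);
      (557153, 2, 3); (267290557130473, 137, 3); (1673377, 2, 5); (20309857, 2, 5);
      (26702061410237462797, 20309857, 3); (79637237, 163, 3); (558497, 2, 3);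
      (4692319993969, 2, 7); (6786509, 97, 3)]%num.

(** Non-3-Higgs numbers whose multiples [d] are excluded by [not_H_nonhiggs_divisor]. *)
Definition nonhiggs_divisors : seq N :=
  [:: 17; 97; 103; 113; 137; 163; 193; 227; 239; 241; 257; 389; 401; 409; 487; 653; 673;
      1009; 1021; 1031; 1097; 1123; 1153; 1187; 1201; 1217; 1229; 1237; 1249; 1259; 1283;
      1297; 1307; 1327; 1667; 1697; 1733; 1747; 1777; 1783; 1871; 1873; 1889; 1907; 1913;
      1931; 3041; 3061; 3079; 3089; 3121; 3137; 3163; 3167; 3169; 3203; 3209; 3217; 3299;
      3313; 3329; 3347; 3361; 3371; 3391; 3457; 3463; 3467; 3469; 5009; 5023; 5101; 5153;
      5189; 5197; 5233; 5237; 5281; 5297; 5303; 5309; 5323; 5347; 5387; 5393; 5407; 5441;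
      5449; 5483; 5507; 5521; 5527; 5563; 5569; 5639; 5651; 5717; 5737; 5749; 5791; 5821;
      5827; 15073; 15121; 15131; 15137; 15173; 15199; 15217; 15233; 15299; 15307; 15313;
      15329; 15359; 15361; 15377; 15383; 15391; 15451; 15461; 15473; 15559; 15569; 15601;
      15607; 15619; 15641; 15647; 15649; 15683; 15761; 15809; 15859; 15877; 15889; 15907;
      15913; 15937; 16001; 16033; 16069; 16097; 16103; 16139; 16187; 16193; 16223; 16253;
      16273; 16301; 16333; 16339; 16361; 16363; 16369; 16417; 16433; 16447; 16481; 16519;
      16529; 16547; 16561; 16619; 16649; 16657; 16661; 16673; 16729; 16763; 16823; 16831;
      16843; 16871; 16879; 16963; 16979; 16993; 17011; 17027; 17033; 17041; 17093; 17099;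
      17117; 17137; 17207; 17209; 17239; 17321; 17333; 17341; 17377; 17383; 17393; 17443;
      17471; 17477; 17489; 17497]%num.

(** Pairs [(k, n)] with [n] a divisor of [4 ^ k + 1], which excludes the odd multiples of
    [k]. *)
Definition witnesses : seq (N * N) :=
  [:: (7, 113); (11, 2113); (19, 525313); (25, 8101); (27, 246241); (29, 107367629);
      (37, 593); (39, 1249); (43, 500177); (45, 54001); (47, 3761); (53, 15358129);
      (59, 157649); (65, 108140989558681); (67, 2559066073); (71, 148587949); (73, 9929);
      (79, 381364611866507317969); (83, 13063537); (101, 9491060093); (107, 23528569104401);
      (109, 74323515777853); (127, 26417); (131, 269665073); (139, 1408349); (167, 75005713);
      (169, 180201997); (173, 13625405957); (181, 28739737348957); (183, 5080081);
      (191, 25212001); (223, 95768689); (251, 57762875981); (263, 99972364781); (269, 8609);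
      (277, 987879984327104437); (281, 3827221); (367, 92525303484856757); (397, 25409);
      (403, 25793); (419, 53633); (503, 350862114989); (509, 103837); (521, 16673);
      (523, 8369); (529, 425654561); (537, 111697); (541, 1281089); (659, 1534153);
      (661, 36371821254913); (677, 480170172376488257); (687, 10993); (691, 11057);
      (701, 1649929681); (719, 980996410232957); (733, gauss733_factor); (739, 170756297);
      (743, 260683037); (1019, 207877); (1039, 47577889); (1051, 1513441); (1061, 49459577);
      (1063, 119057); (1093, 13155349); (1103, 525029); (1151, 36833); (1163, 37217);
      (1171, 13152673); (1181, 7493076529); (1193, 293731580424649); (1231, 37960322381);
      (1277, 61297); (1279, 1146568796702009883941); (1289, 2206769); (1303, 62643029);
      (1319, 28736963309); (1321, 592880653); (1669, 603008777268061313); (1721, 85967393);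
      (1723, 2099331561841897633); (1753, 6923494537); (1789, 5796361); (1823, 58337);
      (1831, 46229089); (1847, 88657); (1861, 1949940913); (1877, 22810159626697);
      (1901, 4884847621); (3001, 48017); (3019, 3034173155873); (3023, 290209);
      (3049, 731761); (3067, 8280028973); (3083, 39825936273533); (3099, 1698253);
      (3109, 198977); (3119, 64326257); (3147, 5349901); (3181, 90556709); (3187, 50993);
      (3191, 1952893); (3221, 1185329); (3229, 73052897); (3253, 1145057);
      (3257, 14650239496544101); (3259, 2555057); (3307, 10476577); (3343, 6943330769);
      (3359, 161233); (3389, 541861937294157972258937); (3407, 2071457); (3427, 54833);
      (3449, 6306332272417); (3461, 1772033); (3473, 6617801501); (3491, 1029356261);
      (3499, 38097113); (5011, 6975313); (5051, 263875783252905713); (5065, 81041);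
      (5077, 472485929); (5079, 2275393); (5087, 19757909); (5099, 54804053);
      (5107, 7680929); (5119, 1740461); (5127, 3978553); (5167, 13227521);
      (5171, 1189330001); (5209, 15251953); (5261, 2609287649); (5273, 49355281);
      (5277, 1794181); (5345, 45795961); (5359, 39613729); (5361, 171553);
      (5399, 38656796809); (5403, 518689); (5413, 49063433); (5417, 3553553);
      (5435, 422364721); (5437, 508402997); (5443, 993230477350621); (5455, 1112821);
      (5501, 4488817); (5503, 1921735649); (5519, 4551144491420249); (5545, 88721);
      (5557, 87044849); (5573, 8671589); (5581, 40902436574189); (5591, 1341841);
      (5601, 5556193); (5641, 77800673); (5645, 270961); (5647, 45943993); (5653, 7326289);
      (5657, 269949120989); (5669, 385493); (5683, 12752653); (5693, 145168676273);
      (5711, 25905097); (5741, 126761281); (5743, 5857861); (5779, 2773921);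
      (5783, 31135673); (5799, 2969089); (5801, 2529421633); (5807, 743297);
      (15009, 289673701); (15013, 5835267153879179953); (15017, 420430468457);
      (15031, 65919485481390137); (15053, 2001348131115761); (15055, 240881);
      (15061, 7229281); (15063, 20336202478149256973722417);
      (15077, 2119341458736479619933149); (15083, 1447969); (15091, 105274817);
      (15101, 483233); (15107, 1208561); (15117, 241873); (15129, 484129);
      (15139, 3970414697); (15149, 8685958376369); (15161, 5367539797); (15185, 115891921);
      (15187, 270851032801); (15221, 487073); (15227, 298363928801);
      (15241, 136304682777048034541); (15243, 2536435201); (15259, 52162834096079628121);
      (15263, 488417); (15269, 1851335713); (15277, 1336798609); (15287, 1039517);
      (15289, 311757999001); (15291, 1223281); (15293, 31197721); (15319, 4411873);
      (15331, 6861787657); (15339, 10203011953); (15349, 187754677829); (15373, 26626037);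
      (15401, 113597777); (15413, 40896978010656137); (15427, 246833);
      (15441, 54976503167828383644229); (15443, 13154564244428801); (15467, 8166577);
      (15469, 1732529); (15493, 247889); (15511, 2334632084689); (15527, 723682417);
      (15537, 1396403413); (15539, 890822091773); (15541, 248657); (15551, 5577838589381);
      (15583, 98314794808753); (15643, 21211909); (15661, 2758470218437); (15667, 250673);
      (15669, 501409); (15671, 11900946040801); (15679, 61474913077); (15681, 6272401);
      (15693, 2149187737); (15703, 6029953); (15709, 8558262071779621); (15731, 14283749);
      (15737, 49755484057); (15739, 28679324144425313); (15749, 392339089);
      (15767, 90681962730402289); (15773, 5110047762237329);
      (15787, 2790932646868953247750880209); (15791, 841075969837);
      (15797, 7936597814527189); (15803, 172126277); (15823, 7729963860257);
      (15837, 1013569); (15881, 1944301873515565961); (15887, 182827597); (15899, 104679017);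
      (15919, 1211039269580314693); (15923, 182095429); (15931, 1784273);
      (15973, 1644835649); (15999, 19582777); (16007, 10162046049931438241);
      (16053, 99913873); (16057, 33013193); (16061, 850146065159844967561);
      (16067, 1584122137457); (16073, 3810358523810747273); (16091, 1540874161);
      (16111, 15659893); (16127, 633412209423649); (16141, 13703767301293);
      (16143, 338098993); (16183, 108018482597); (16189, 3302557); (16217, 177783143789);
      (16229, 2171483372710381); (16231, 5793459898913); (16249, 342658913);
      (16255, 3901201); (16257, 1312200013); (16293, 97497313); (16299, 8345089);
      (16307, 4344576169); (16319, 2160978281026383953); (16349, 526195050049);
      (16355, 29373581); (16411, 1790180235553097581); (16413, 29257175071693);
      (16421, 788209); (16427, 4979329373617); (16431, 2103169);
      (16437, 915242169987001473432769); (16453, 93418972107830609); (16477, 4706474198449);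
      (16487, 8255653400675668661); (16493, 26117480969600369); (16505, 44365441);
      (16531, 11108833); (16553, 6888431633); (16573, 23069617); (16593, 10037010141443977);
      (16595, 51776401); (16603, 165356914381); (16615, 265841); (16631, 7016153233);
      (16633, 3629307626261); (16651, 2267960365874661233); (16655, 799441);
      (16699, 28093262069); (16703, 1336241); (16721, 199782509); (16741, 1222299249121);
      (16747, 151934277017); (16755, 5897761); (16759, 1301987336597); (16783, 268529);
      (16811, 806929); (16829, 5468482577); (16865, 9714241); (16869, 616875233443213);
      (16883, 30578144017460391589); (16901, 43339476130371151553); (16911, 47041531633);
      (16913, 1456490161074204979529); (16921, 916649022945223349);
      (16927, 499118861480510377); (16931, 2840698891969); (16937, 58669769);
      (16943, 216720625099897); (16957, 4340993); (16977, 33632183989); (16981, 3799804409);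
      (17021, 82722061); (17047, 185198609); (17053, 33926875289); (17065, 49312935281);
      (17067, 5461441); (17077, 273233); (17103, 4968030251773); (17107, 10651776193);
      (17159, 114784455464941); (17165, 136348804301); (17167, 407579363088721);
      (17183, 11017395596341); (17189, 321497280497); (17191, 43183793);
      (17203, 673971187232486413); (17231, 16472837); (17257, 276113); (17261, 1539197893);
      (17263, 62152014654089821); (17267, 71830721); (17273, 19622129);
      (17291, 119530318030944713); (17293, 609864170129866021); (17299, 282734857);
      (17317, 277073); (17327, 4866807761); (17351, 2878877921); (17359, 53103344348017);
      (17387, 187496296013357); (17389, 371815146090233137); (17401, 8352481);
      (17411, 557153); (17419, 267290557130473); (17431, 1673377);
      (17439, 26702061410237462797); (17449, 79637237); (17453, 558497);
      (17483, 4692319993969); (17491, 6786509)]%num.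

(** * Reaching every exponent *)

Definition half_candidates : seq N :=
  [:: 15177; 15193; 15271; 15439; 15497; 15581; 15629; 15727; 15733; 15769; 15817;
      15901; 15959; 15971; 15991; 16063; 16087; 16267; 16381; 16451; 16567; 16607;
      16691; 16693; 16787; 16889; 16903; 16987; 17029; 17123; 17417; 17467]%num.

Definition certified : seq N := [seq s.1.1 | s <- certificate].

Definition witness_ok (w : N * N) : bool :=
  [&& w.1 != 0%num, w.2 \in certified, N.ltb 1 w.2
    & N.eqb (N.modulo (power (reduction w.2) 4 w.1) w.2) (N.pred w.2)].

Definition divides (k d : N) : bool := N.eqb (N.modulo d k) 0.

Definition excluded (d : N) : bool :=
  has (divides^~ d) nonhiggs_divisors || has (fun w => divides w.1 d) witnesses.

Lemma certificate_ok : nonhiggs_chain [::] certificate.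
Proof. by vm_compute. Qed.

Lemma certified_nonhiggs n : n \in certified -> nonhiggs_factors (N.to_nat n).
Proof. by apply: (nonhiggs_chainP (known := [::]) _ certificate_ok). Qed.

Lemma nonhiggs_divisors_ok :
  all (fun r => (r \in certified) && N.ltb 1 r) nonhiggs_divisors.
Proof. by vm_compute. Qed.

Lemma witnesses_ok : all witness_ok witnesses.
Proof. by vm_compute. Qed.

(** The odd numbers between 15000 and 17500, starting from [15001 = 2 * 7500 + 1]. *)
Definition half_index (i : nat) : N := N.succ_double (N.add 7500 (N.of_nat i)).

Lemma half_range_covered i : i < 1250 ->
  excluded (half_index i) || (half_index i \in half_candidates).
Proof.
pose P j := excluded (half_index j) || (half_index j \in half_candidates).
move=> i1; have : all P (iota 0 1250) by vm_compute.
by move/allP/(_ i); rewrite mem_iota; apply.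
Qed.

Lemma not_H_excluded d : odd (N.to_nat d) -> excluded d -> ~ H (2 * N.to_nat d).
Proof.
move=> od /orP[/hasP[r /(allP nonhiggs_divisors_ok)]|/hasP[[k n] /(allP witnesses_ok)]].
  case/andP=> rs /N.ltb_spec0 r1 rd.
  have r1' : 1 < N.to_nat r by apply/ltP; lia.
  apply: not_H_nonhiggs_divisor od r1' (certified_nonhiggs rs) _.
  by rewrite dvdn_to_nat //; lia.
rewrite /witness_ok /= => /and4P[/eqP k0 ns /N.ltb_spec0 n1 /N.eqb_spec e] kd.
have n1' : 1 < N.to_nat n by apply/ltP; lia.
have n0 : n <> 0%num by lia.
apply: (not_H_of_nonhiggs_divisor n1' (certified_nonhiggs ns)).
have {kd} kd : N.to_nat k %| N.to_nat d by rewrite dvdn_to_nat.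
rewrite expnM; apply: dvdn_trans (expn_succ_dvd _ kd od).
have := powerE 4 k (reduction_preserves n0).
rewrite -to_nat_mod // e N2Nat.inj_pred => e'.
by rewrite /dvdn -modnDml -e' addn1 prednK ?modnn // ltnW.
Qed.

Lemma candidatesE : candidates == [seq N.to_nat (N.double d) | d <- half_candidates].
Proof. by vm_compute. Qed.

Theorem theorem17 (m : nat) :
  Heven m -> 30000 < m <= 35000 -> m \in candidates.
Proof.
case=> hm /dvdnP[d]; rewrite mulnC => em.
(* Through [N.to_nat], the bounds become binary numerals, which [lia] can handle. *)
have -> : 30000 = N.to_nat 30000 by apply/eqP; vm_compute.
have -> : 35000 = N.to_nat 35000 by apply/eqP; vm_compute.
move=> /andP[/ltP lo /leP hi].
have m0 : 0 < m by apply/ltP; lia.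
case: (boolP (odd d)) => od; last first.
  case: (not_H_mul4 m0 _ hm).
  by rewrite em (_ : 4 = 2 * 2) // dvdn_pmul2l // dvdn2.
have ed : d = Nat.add (Nat.mul 2 d./2) 1.
  by rewrite -{1}(odd_double_half d) od addnC -mul2n.
have em' : m = Nat.mul 2 d by [].
pose i := d./2 - N.to_nat 7500.
have ei : N.to_nat (half_index i) = d.
  by rewrite /half_index N2Nat.inj_succ_double N2Nat.inj_add Nat2N.id /i -minusE; lia.
have i1 : i < 1250 by apply/ltP; rewrite /i -minusE; lia.
case/orP: (half_range_covered i1) => [ex|ic].
  by case: (@not_H_excluded (half_index i)); rewrite ?ei -?em.
rewrite (eqP candidatesE) em -ei mul2n; apply/mapP; exists (half_index i) => //.
by rewrite N2Nat.inj_double multE mul2n.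
Qed.
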